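(* Assume that there are constants $A,B,\ell>0$ and a function $h$ such that $\mathcal{K}(r)=A+Br^{\ell}+h(r)$ and $\lim_{r\to 0}\frac{|h(r)|+r|h'(r)|}{r^{\ell}}=0$. Assume also that $\mathcal{K}(r)$ is increasing (i.e. nondecreasing) for $r\ge 0$, strictly in some interval. Let $\ell_p^*=\frac{n-p}{p-1}$. Then $J=(0,+\infty)$ and - if $\ell=\ell_p^*$, then $\liminf_{d\to+\infty}R(d)>0$; - if $\ell>\ell_p^*$, then $\lim_{d\to+\infty}R(d)=+\infty$.
   Context: Standing assumptions: $n$ is a positive integer, $p$ is real with $1<p<n$ and $\frac{2n}{n+2}\le p\le 2$, $q=\frac{np}{n-p}$, and $\mathcal{K}:[0,+\infty)\to(0,+\infty)$ is $C^1$. For each $d>0$, $u(r;d)$ denotes the unique (regular) solution of $(r^{n-1}u'|u'|^{p-2})'+r^{n-1}\mathcal{K}(r)u|u|^{q-2}=0$ with $\lim_{r\to0}u(r;d)=d$ (it satisfies $u'(0;d)=0$). $J$ is the set of $d>0$ such that $u(\cdot;d)$ is a crossing solution, i.e. has a zero at some finite positive $r$, and for $d\in J$, $R(d)>0$ denotes the first zero of $u(\cdot;d)$. *)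

(* Defs.v *)
From mathcomp Require Import all_boot all_order all_algebra.
From mathcomp Require Import all_classical all_reals all_analysis.

Set Implicit Arguments.
Unset Strict Implicit.
Unset Printing Implicit Defensive.

Import Order.TTheory GRing.Theory Num.Theory.
Import numFieldNormedType.Exports.

Local Open Scope classical_set_scope.
Local Open Scope ring_scope.

(* Functions on [0, +oo[ or ]0, +oo[ are represented by total functions
   R -> R whose values outside that half-line are irrelevant. *)

(* The derivative dK is one-sided at 0. *)
Definition C1_halfline (R : realType) (K : R -> R) : Prop :=
  exists dK : R -> R,
    [/\ {within `[0, +oo[%classic, continuous dK},
        forall r : R, 0 < r -> is_derive r 1 K (dK r) &
        t^-1 * (K t - K 0) @[t --> 0^'+] --> dK 0].

Definition sobolev_exponent (R : realType) (n : nat) (p : R) : R :=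
  n%:R * p / (n%:R - p).

(* x |x|^(s-2).  For 1 < s < 2 the factor |x|^(s-2) is singular at x = 0; the
   product is 0 there, as it should be by continuity. *)
Definition signed_pow (R : realType) (s x : R) : R := x * `|x| `^ (s - 2).

Definition flux (R : realType) (n : nat) (p : R) (v : R -> R) (r : R) : R :=
  r ^+ n.-1 * signed_pow p (v^`()%classic r).

(* Global solution of
     (r^(n-1) v' |v'|^(p-2))' + r^(n-1) K(r) v |v|^(q-2) = 0   on ]0, +oo[
   with v(r) -> d as r -> 0+.  Continuity of v' on ]0, +oo[ follows from that
   of the flux. *)
Definition regular_solution (R : realType) (n : nat) (p : R) (K : R -> R)
    (d : R) (v : R -> R) : Prop :=
  (forall r : R, 0 < r ->
    [/\ derivable v r 1,
        derivable (flux n p v) r 1 &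
        (flux n p v)^`()%classic r
          + r ^+ n.-1 * K r * signed_pow (sobolev_exponent n p) (v r) = 0])
  /\ v r @[r --> 0^'+] --> d.

Definition crossing (R : realType) (v : R -> R) : Prop :=
  exists2 r, 0 < r & v r = 0.

Definition crossing_data (R : realType) (u : R -> R -> R) : set R :=
  [set d | 0 < d /\ crossing (u d)].

Definition is_first_zero (R : realType) (v : R -> R) (r : R) : Prop :=
  [/\ 0 < r, v r = 0 & forall s, 0 < s < r -> v s != 0].

(* Default value 0 when v has no first positive zero. *)
Definition first_zero (R : realType) (v : R -> R) : R :=
  xget 0 [set r | is_first_zero v r].

(* Main.v *)
(** The mass [w = - r^(n-1) u' |u'|^(p-2)] turns the equation into the first
order system [u' = - slope w], [w' = r^(n-1) K u^(q-1)] as long as [u > 0].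
The Pohozaev function [P] satisfies [P' = r^n K' u^q / q >= 0] and vanishes at
[0], so [P >= 0]; equivalently, the ratio [r^n u^(n/L) / w], [L = (n-p)/(p-1)],
is nonincreasing.  This bounds [w] from below by a power of [u] and, after one
integration, [u] from above by a rescaled Aubin-Talenti bubble.

If [u] had no zero, then [P] would be bounded below by a positive constant for
large [r] while [u w = O(r^(-L))], and the ratio, which stays bounded below,
would decrease like [- r^L].

At a zero [T <= M] of [u], [P] equals [(p-1)/p w^(p/(p-1)) T^(-L)] with [w] at
least of order [1/d], whereas integrating [P'] with [K' <= C r^(k-1)] under the
bubble bound, split at the scale [r = d^(-p/(n-p))], gives
[P <= C' d^(-kp/(n-p))].  Hence [T^(-L) <= C'' d^(p/(n-p) (L-k))]. *)
Require Import Defs.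
From mathcomp Require Import all_boot all_order all_algebra.
From mathcomp Require Import all_classical all_reals all_analysis.
From mathcomp Require Import ring lra.
Set Implicit Arguments.
Unset Strict Implicit.
Unset Printing Implicit Defensive.
Import Order.TTheory GRing.Theory Num.Theory.
Import numFieldNormedType.Exports.
Local Open Scope classical_set_scope.
Local Open Scope ring_scope.

Ltac pos_rec := first
  [ assumption
  | match goal with
    | |- is_true (0 < _ * _) => apply: mulr_gt0; pos_rec
    | |- is_true (0 < _^-1) => rewrite invr_gt0; pos_rec
    | |- is_true (0 < _ `^ _) => apply: powR_gt0; pos_rec
    | |- is_true (0 < _ + _) => apply: addr_gt0; pos_rec
    | |- is_true (0 <= _ * _) => apply: mulr_ge0; pos_rec
    | |- is_true (0 <= _^-1) => rewrite invr_ge0; pos_rec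
    | |- is_true (0 <= _ `^ _) => exact: powR_ge0
    | |- is_true (0 <= _) => apply: ltW; pos_rec
    end
  | solve [auto] | done ].
Ltac pos := solve [pos_rec].

(* [field] whose side conditions are among the hypotheses. *)
Ltac fieldp := field; repeat (apply/andP; split);
  try (apply: lt0r_neq0; assumption); try assumption; try done.

(* Equality of two products of real powers, once every positive base has been
   written as an exponential with [pos_expR]. *)
Ltac exp_eq := rewrite -?(expRM, expRN, expRD); congr expR; fieldp.

(** * Monotonicity from the sign of a derivative, logarithmic derivatives, real powers *)

Section calculus.
Variable R : realType.
Implicit Types (f g df : R -> R) (a b c e k r s t x y : R).

Lemma pos_expR (x : R) : 0 < x -> exists y, x = expR y.
Proof. by move=> x0; exists (ln x); rewrite lnK. Qed.

Lemma MVT_itvoo a b f df :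
  (forall r, a < r < b -> is_derive r 1 f (df r)) ->
  forall r s, a < r -> r <= s -> s < b ->
  exists2 x, a < x < b & f s - f r = df x * (s - r).
Proof.
move=> dfE r s ar rs sb.
have inab x : x \in `[r, s] -> a < x < b.
  rewrite in_itv/= => /andP[rx xs].
  by rewrite (lt_le_trans ar rx) (le_lt_trans xs sb).
have fd x : x \in `]r, s[ -> is_derive x 1 f (df x).
  by move=> xI; apply: dfE; apply: inab; apply: subset_itv_oo_cc xI.
have fc : {within `[r, s], continuous f}.
  by apply: derivable_within_continuous => x xI; have [] := dfE x (inab _ xI).
by have [x /inab xI E] := MVT_segment rs fd fc; exists x.
Qed.

Lemma derive_le0_nonincr a b f df :
  (forall r, a < r < b -> is_derive r 1 f (df r)) ->
  (forall r, a < r < b -> df r <= 0) ->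
  forall r s, a < r -> r <= s -> s < b -> f s <= f r.
Proof.
move=> dfE df_le0 r s ar rs sb; have [x xI E] := MVT_itvoo dfE ar rs sb.
by rewrite -subr_le0 E mulr_le0_ge0 ?subr_ge0// df_le0.
Qed.

Lemma derive_lt0_decr a b f df :
  (forall r, a < r < b -> is_derive r 1 f (df r)) ->
  (forall r, a < r < b -> df r < 0) ->
  forall r s, a < r -> r < s -> s < b -> f s < f r.
Proof.
move=> dfE df_lt0 r s ar rs sb; have [x xI E] := MVT_itvoo dfE ar (ltW rs) sb.
by rewrite -subr_lt0 E nmulr_rlt0 ?subr_gt0// df_lt0.
Qed.

Lemma derive_ge0_nondecr a b f df :
  (forall r, a < r < b -> is_derive r 1 f (df r)) ->
  (forall r, a < r < b -> 0 <= df r) ->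
  forall r s, a < r -> r <= s -> s < b -> f r <= f s.
Proof.
move=> dfE df_ge0 r s ar rs sb; rewrite -lerN2.
apply: (@derive_le0_nonincr a b (- f) (fun x => - df x)) => // x xI.
  exact/is_deriveN/dfE.
by rewrite oppr_le0 df_ge0.
Qed.

(** If [f r < 0], monotonicity gives [- g s <= f s <= f r] for all small [s], against [g] tending to
    0. This serves as integration from 0: it asks for no value or limit of [f] at 0, only for a
    lower bound that vanishes there. *)
Lemma nondecr_cvg0_ge0 b f g :
  (forall r s, 0 < r -> r <= s -> s < b -> f r <= f s) ->
  (forall r, 0 < r < b -> - g r <= f r) ->
  g x @[x --> 0^'+] --> 0 ->
  forall r, 0 < r < b -> 0 <= f r.
Proof.
move=> f_nd gf g0 r /andP[r0 rb].
rewrite leNgt; apply/negP => fr.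
have /cvgrPdist_lt/(_ (- f r)) := g0; rewrite oppr_gt0 => /(_ fr) gs.
near (0:R)^'+ => s.
have s0 : 0 < s by near: s; exact: nbhs_right_gt.
have sr : s < r by near: s; exact: nbhs_right_lt.
have : `|0 - g s| < - f r by near: s.
rewrite sub0r normrN => gsr.
have := gf s; rewrite s0 (lt_trans sr rb) => /(_ isT).
have := f_nd s r s0 (ltW sr) rb.
have := ler_norm (g s); lra.
Unshelve. all: end_near. Qed.

Lemma near_right0_ex (P : R -> Prop) : (\forall r \near 0^'+, P r) ->
  exists2 e, 0 < e & forall r, 0 < r < e -> P r.
Proof.
move=> [e /= e0 eP]; exists e => // r /andP[r0 re]; apply: eP => //=.
by rewrite sub0r normrN gtr0_norm.
Qed.

(* Logarithmic derivative [f' / f = t] at [x]: it is additive on products and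
   scaled by powers. *)
Definition log_derive f x t := is_derive x 1 f (f x * t).

Lemma log_derive_id x : 0 < x -> log_derive id x x^-1.
Proof.
by move=> x0; rewrite /log_derive mulfV ?gt_eqF//; exact: is_derive_id.
Qed.

Lemma log_derivePE f x t : f x != 0 -> is_derive x 1 f t ->
  log_derive f x (t / f x).
Proof.
by move=> fx; rewrite /log_derive mulrC divfK.
Qed.

Lemma log_deriveM f g x s t : log_derive f x s -> log_derive g x t ->
  log_derive (fun y => f y * g y) x (s + t).
Proof.
move=> df dg; apply: (is_derive_eq (is_deriveM df dg)).
by rewrite /GRing.scale/=; ring.
Qed.

Lemma log_derive_powR f x t e : 0 < f x -> log_derive f x t ->
  log_derive (fun y => f y `^ e) x (e * t).
Proof.
move=> fx df.
apply: (is_derive_eq (is_derive1_comp (is_derive1_powR e fx) df)).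
rewrite /= (@powRB _ (f x) e 1) ?(gt_eqF fx) ?implybT// powRr1 ?ltW//.
by field; rewrite gt_eqF.
Qed.

Lemma nondecr_derive_ge0 f t x : 0 < x ->
  (forall r, 0 < r -> derivable f r 1) ->
  (forall r s, 0 < r -> r <= s -> f r <= f s) ->
  is_derive x 1 f t -> 0 <= t.
Proof.
move=> x0 fd f_nd dft; rewrite leNgt; apply/negP => t0.
(* Adding a line of slope [- t / 2 > 0] makes [f] strictly increasing and leaves the derivative
   [t / 2], still negative. *)
have c0 : 0 < - t / 2 by rewrite divr_gt0// oppr_gt0.
have did y : is_derive y 1 (fun z : R => - t / 2 * z) (- t / 2 * 1).
  exact: (is_deriveZ (- t / 2) (is_derive_id y 1)).
pose g y := f y + (- t / 2) * y.
have gE : derive1 g x = t / 2.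
  by rewrite derive1E; have [_ ->] := is_deriveD dft (did x); field.
have : 0 <= derive1 g x.
  apply: (@incr_derive1_ge0_itvy R g false 0 x).
  - move=> y; rewrite inE /= in_itv/= andbT => y0; apply: derivableD;
      first exact: fd.
    by have [] := did y.
  - move=> y z; rewrite !in_itv/= !andbT => y0 z0 yz.
    by rewrite /g ler_ltD ?f_nd ?(ltW yz)// ltr_pM2l.
  - by rewrite in_itv/= x0.
by rewrite gE pmulr_lge0// leNgt t0.
Qed.

Lemma powRN_unbounded A B c r : 0 < A -> 0 < c -> 0 < r ->
  exists2 s, 0 < s < r & B < A * s `^ (- c).
Proof.
move=> A0 c0 r0.
have B0 : 0 < (`|B| + 1) / A by rewrite divr_gt0// ltr_wpDl.
(* The solution of [A * y^(-c) = |B| + 1]; a smaller argument only increases the left-hand side. *)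
pose y := ((`|B| + 1) / A) `^ (- c^-1).
have y0 : 0 < y by exact: powR_gt0.
pose s := Num.min (r / 2) y.
have s0 : 0 < s by rewrite lt_min divr_gt0.
have sy : s <= y by rewrite /s ge_min lexx orbT.
exists s.
  by rewrite s0 /s gt_min ltr_pdivrMr// ltr_pMr// ltr1n.
apply: (@lt_le_trans _ _ (A * y `^ (- c))).
  rewrite /y -powRrM mulrNN mulVf ?gt_eqF// powRr1 ?(ltW B0)//.
  rewrite mulrC divfK ?gt_eqF//.
  by apply: le_lt_trans (ler_norm B) _; rewrite ltrDl.
rewrite ler_wpM2l ?(ltW A0)// !powRN lef_pV2 ?posrE ?powR_gt0//.
by rewrite ge0_ler_powR ?nnegrE ?(ltW c0) ?(ltW s0) ?(ltW y0).
Qed.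

Lemma signed_pow_gt0 s x : 0 < x -> signed_pow s x = x `^ (s - 1).
Proof.
move=> x0; rewrite /signed_pow gtr0_norm//.
by have [X ->] := pos_expR x0; rewrite -?(expRM, expRD); congr expR; ring.
Qed.

Lemma signed_powN s x : signed_pow s (- x) = - signed_pow s x.
Proof. by rewrite /signed_pow normrN mulNr. Qed.

Lemma signed_pow_inv s x y : 1 < s -> 0 < y -> signed_pow s x = y ->
  x = y `^ (s - 1)^-1.
Proof.
move=> s1 y0 xy.
have x0 : 0 < x.
  rewrite ltNge; apply/negP => x0; move: y0; rewrite -xy ltNge => /negP; apply.
  by rewrite /signed_pow mulr_le0_ge0// powR_ge0.
rewrite -xy signed_pow_gt0// -powRrM mulfV ?subr_eq0 ?gt_eqF// powRr1//.
exact: ltW.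
Qed.

End calculus.

(** * The first-order radial system in real dimension [N] *)

Section radial.
Variables (R : realType) (N p : R).
Hypotheses (p_gt1 : 1 < p) (p_ltN : p < N).
(** [d^(-b)] is the length scale of a solution of height [d]. The powers below match through
    [b * N = q], [N / L = q - 1 - b] and [p' * N = q * L]. *)
Local Notation a := ((p - 1)^-1).
Local Notation L := ((N - p) / (p - 1)).
Local Notation q := (N * p / (N - p)).
Local Notation b := (p / (N - p)).
Local Notation p' := (p / (p - 1)).
Implicit Types (u w : R -> R) (r s t d T c e : R).

Let p0 : 0 < p. Proof. by move: p_gt1; lra. Qed.
Let N0 : 0 < N. Proof. by move: p_gt1 p_ltN; lra. Qed.
Let p1n0 : p - 1 != 0. Proof. by rewrite subr_eq0 gt_eqF. Qed.
Let Npn0 : N - p != 0. Proof. by rewrite subr_eq0 gt_eqF. Qed.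
Let pn0 : p != 0. Proof. by rewrite gt_eqF. Qed.
Let Nn0 : N != 0. Proof. by rewrite gt_eqF. Qed.
Let p1_gt0 : 0 < p - 1. Proof. by rewrite subr_gt0. Qed.
Let Np_gt0 : 0 < N - p. Proof. by rewrite subr_gt0. Qed.
Let a0 : 0 < a. Proof. by rewrite invr_gt0. Qed.
Let L0 : 0 < L. Proof. exact: divr_gt0. Qed.
Let q0 : 0 < q. Proof. by rewrite divr_gt0// mulr_gt0. Qed.
Let b0 : 0 < b. Proof. exact: divr_gt0. Qed.
Let p'0 : 0 < p'. Proof. exact: divr_gt0. Qed.
Let q1 : 0 < q - 1.
Proof.
rewrite (_ : q - 1 = (N * (p - 1) + p) / (N - p)); last by fieldp.
by rewrite divr_gt0// addr_gt0// mulr_gt0.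
Qed.

(* [|u'|] in terms of [w = r^(N-1) |u'|^(p-1)]; note [L + 1 = (N-1)/(p-1)]. *)
Definition slope w r := w r `^ a * r `^ (- (L + 1)).

Section profile.
Variables (K dK : R -> R) (K0 : R).
Hypothesis K0_gt0 : 0 < K0.
Hypothesis K_ge : forall r, 0 < r -> K0 <= K r.
Hypothesis dKE : forall r, 0 < r -> is_derive r 1 K (dK r).
Hypothesis dK_ge0 : forall r, 0 < r -> 0 <= dK r.

Let K_gt0 r : 0 < r -> 0 < K r.
Proof. by move=> /K_ge; exact: lt_le_trans. Qed.

(** The endpoint [T] is left out and 0 enters only through limits, so the predicate covers both an
    interval ending at the first zero and, when it holds for all [T], a positive global solution. *)
Definition radial_profile d T u w : Prop :=
  [/\ forall r, 0 < r < T ->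
        [/\ 0 < u r, 0 < w r, is_derive r 1 u (- slope w r) &
            is_derive r 1 w (r `^ (N - 1) * K r * u r `^ (q - 1))],
      u r @[r --> 0^'+] --> d & w r @[r --> 0^'+] --> 0].

Definition pohozaev u w r :=
  (p - 1) / p * (r * w r * slope w r) - (N - p) / p * (u r * w r)
  + (N - p) / (N * p) * (K r * (r `^ N * u r `^ q)).

(** For constant [K] the Pohozaev function vanishes identically and this ratio is constant; the
    solutions are then Aubin-Talenti bubbles. *)
Definition decay_ratio u w r := r `^ N * u r `^ (N / L) / w r.

(** * Pohozaev identity, monotone decay ratio and the bubble bound *)

Section identities.
Variables (d T : R) (u w : R -> R).
Hypothesis d0 : 0 < d.
Hypothesis uw : radial_profile d T u w.

Let u_gt0 r : 0 < r < T -> 0 < u r. Proof. by case: uw => h _ _ /h[]. Qed.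
Let w_gt0 r : 0 < r < T -> 0 < w r. Proof. by case: uw => h _ _ /h[]. Qed.
Let du r : 0 < r < T -> is_derive r 1 u (- slope w r).
Proof. by case: uw => h _ _ /h[]. Qed.
Let dw r : 0 < r < T ->
  is_derive r 1 w (r `^ (N - 1) * K r * u r `^ (q - 1)).
Proof. by case: uw => h _ _ /h[]. Qed.
Let slope_gt0 r : 0 < r < T -> 0 < slope w r.
Proof.
by move=> rT; case/andP: (rT) => r0 _; rewrite mulr_gt0 ?powR_gt0// w_gt0.
Qed.

Let dwE r : 0 < r < T -> r * u r * (r `^ (N - 1) * K r * u r `^ (q - 1)) =
  K r * (r `^ N * u r `^ q).
Proof.
move=> rT; have ur := u_gt0 rT; case/andP: rT => r0 _.
by rewrite -(mulr_powRB1 (ltW r0) N0) -(mulr_powRB1 (ltW ur) q0); ring.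
Qed.

(** Each product is differentiated logarithmically. Once [w'] is expressed through [r^N u^q], the
    claim is a rational identity in which all terms without [dK] cancel. *)
Lemma pohozaev_derive r : 0 < r < T -> is_derive r 1 (pohozaev u w)
  ((N - p) / (N * p) * (dK r * (r `^ N * u r `^ q))).
Proof.
move=> rT; have ur := u_gt0 rT; have wr := w_gt0 rT; have sr := slope_gt0 rT.
case/andP: (rT) => r0 _.
have lu := log_derivePE (lt0r_neq0 ur) (du rT).
have lw := log_derivePE (lt0r_neq0 wr) (dw rT).
have lr := log_derive_id r0.
have ls := log_deriveM (log_derive_powR a wr lw)
  (log_derive_powR (- (L + 1)) (f := id) r0 lr).
have lrws := log_deriveM (log_deriveM lr lw) ls.
have luw := log_deriveM lu lw.
have lru := log_deriveM (log_derive_powR N (f := id) r0 lr)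
  (log_derive_powR q ur lu).
have dKru := is_deriveM (dKE r0) lru.
apply: (is_derive_eq (is_deriveD (is_deriveB
  (is_deriveZ ((p - 1) / p) lrws) (is_deriveZ ((N - p) / p) luw))
  (is_deriveZ ((N - p) / (N * p)) dKru))).
rewrite /GRing.scale /= -[w r `^ a * r `^ (- (L + 1))]/(slope w r).
have := dwE rT.
set F := r `^ N * u r `^ q; set W := r `^ (N - 1) * K r * u r `^ (q - 1).
set S := slope w r.
move=> FE; have -> : W = K r * F / (r * u r).
  by rewrite -FE; fieldp.
by fieldp.
Qed.

(** The logarithmic derivative of the ratio is [N / r - (N / L) * slope / u - w' / w]. Multiplying
    [pohozaev] by [q / (r * u * w)] gives its opposite, which dictates the exponent [N / L]. *)
Lemma decay_ratio_derive r : 0 < r < T -> is_derive r 1 (decay_ratio u w)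
  (- (q * decay_ratio u w r * pohozaev u w r / (r * (u r * w r)))).
Proof.
move=> rT; have ur := u_gt0 rT; have wr := w_gt0 rT; have sr := slope_gt0 rT.
case/andP: (rT) => r0 _.
have lu := log_derivePE (lt0r_neq0 ur) (du rT).
have lw := log_derivePE (lt0r_neq0 wr) (dw rT).
have lr := log_derive_id r0.
have lw1 := log_derive_powR (-1) wr lw.
have := log_deriveM (log_deriveM (log_derive_powR N (f := id) r0 lr)
  (log_derive_powR (N / L) ur lu)) lw1.
rewrite /log_derive /= powR_inv1 ?ltW// -/(decay_ratio u w r) => dH.
have : is_derive r 1 (decay_ratio u w) (decay_ratio u w r *
   (N * r^-1 + N / L * (- slope w r / u r) +
     -1 * (r `^ (N - 1) * K r * u r `^ (q - 1) / w r))).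
  apply: near_eq_is_derive dH.
  have /near_in_itvoo : r \in `]0, T[ by rewrite in_itv.
  apply: filterS => s; rewrite in_itv/= => sT.
  by rewrite /decay_ratio powR_inv1// ltW// w_gt0.
move=> /is_derive_eq; apply; rewrite /pohozaev -dwE//.
set W := r `^ (N - 1) * K r * u r `^ (q - 1).
by fieldp.
Qed.

Lemma mass_nondecr r s : 0 < r -> r <= s -> s < T -> w r <= w s.
Proof.
apply: (derive_ge0_nondecr dw) => t tT; have ut := u_gt0 tT.
case/andP: tT => t0 _.
by rewrite !mulr_ge0 ?powR_ge0// ltW// K_gt0.
Qed.

Lemma profile_nonincr r s : 0 < r -> r <= s -> s < T -> u s <= u r.
Proof.
apply: (derive_le0_nonincr du) => t tT.
by rewrite oppr_le0 ltW// slope_gt0.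
Qed.

Lemma profile_le r : 0 < r < T -> u r <= d.
Proof.
case: uw => _ ud _ rT; rewrite -subr_ge0.
apply: (@nondecr_cvg0_ge0 R T (fun x => d - u x) (fun x => u x - d)) rT.
- by move=> s t s0 st tT; rewrite lerD2l lerN2 profile_nonincr.
- by move=> s _; rewrite opprB.
- by rewrite -[X in _ --> X](subrr d); apply: cvgB => //; exact: cvg_cst.
Qed.

(** Only the term in [u * w] is negative, and it vanishes at 0 because [u] tends to [d] and [w] to
    0; [dK >= 0] gives the monotonicity. *)
Lemma pohozaev_ge0 r : 0 < r < T -> 0 <= pohozaev u w r.
Proof.
case: uw => _ ud w0.
apply: (@nondecr_cvg0_ge0 R T _ (fun x => (N - p) / p * (u x * w x))).
- apply: (derive_ge0_nondecr pohozaev_derive) => t tT; have ut := u_gt0 tT.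
  case/andP: tT => t0 _.
  by rewrite !mulr_ge0 ?powR_ge0 ?dK_ge0 ?invr_ge0 ?mulr_ge0// ltW.
- move=> s sT; have us := u_gt0 sT; have ws := w_gt0 sT;
    have ss := slope_gt0 sT.
  case/andP: sT => s0 _.
  rewrite /pohozaev -addrA addrCA lerDl addr_ge0//.
    pos.
  have Ks := K_gt0 s0; pos.
- suff : (N - p) / p * (u x * w x) @[x --> 0^'+] --> (N - p) / p * (d * 0).
    by rewrite !mulr0.
  by apply: cvgM; [exact: cvg_cst|exact: cvgM].
Qed.

Lemma pohozaev_nondecr r s : 0 < r -> r <= s -> s < T ->
  pohozaev u w r <= pohozaev u w s.
Proof.
apply: (derive_ge0_nondecr pohozaev_derive) => t tT; have ut := u_gt0 tT.
case/andP: tT => t0 _.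
by rewrite !mulr_ge0 ?powR_ge0 ?dK_ge0 ?invr_ge0 ?mulr_ge0// ltW.
Qed.

Lemma decay_ratio_nonincr r s : 0 < r -> r <= s -> s < T ->
  decay_ratio u w s <= decay_ratio u w r.
Proof.
apply: (derive_le0_nonincr decay_ratio_derive) => t tT.
have := pohozaev_ge0 tT; have ut := u_gt0 tT; have wt := w_gt0 tT.
case/andP: tT => t0 _ Pt.
rewrite oppr_le0 !mulr_ge0 ?invr_ge0 ?mulr_ge0 ?powR_ge0// ltW//.
Qed.

Let powR_mulN_cvg0 c : c * r `^ N @[r --> 0^'+] --> 0.
Proof.
rewrite -[X in _ --> X](mulr0 c); apply: cvgM; first exact: cvg_cst.
exact: powR_cvg0.
Qed.

Let dpow c r : 0 < r ->
  is_derive r 1 (fun x => c / N * x `^ N) (c * r `^ (N - 1)).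
Proof.
move=> r0; apply: (is_derive_eq (is_deriveZ (c / N) (is_derive1_powR N r0))).
by rewrite /GRing.scale /= mulrA divfK.
Qed.

Lemma mass_ge e t : 0 <= e -> t <= T -> (forall r, 0 < r < t -> e <= u r) ->
  forall r, 0 < r < t -> K0 * e `^ (q - 1) / N * r `^ N <= w r.
Proof.
move=> e0 tT eu r rt; set c := K0 * _; rewrite -subr_ge0.
have ltT s : 0 < s < t -> 0 < s < T.
  by move=> /andP[-> st]; rewrite (lt_le_trans st).
apply: (@nondecr_cvg0_ge0 R t (fun x => w x - c / N * x `^ N) (fun x =>
  c / N * x `^ N)) rt => //.
- apply: (derive_ge0_nondecr (df := fun x =>
    x `^ (N - 1) * K x * u x `^ (q - 1) - c * x `^ (N - 1))) => s st.
    by apply: is_deriveB; [exact/dw/ltT|apply: dpow; case/andP: st].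
  case/andP: (st) => s0 _.
  rewrite subr_ge0 [leLHS]mulrC -mulrA ler_wpM2l ?powR_ge0//.
  apply: ler_pM; rewrite ?powR_ge0 ?K_ge//; first exact: ltW.
  by rewrite ge0_ler_powR ?nnegrE ?(ltW q1) ?eu// ltW// u_gt0// ltT.
- by move=> s /ltT sT; rewrite lerDr ltW// w_gt0.
Qed.

Lemma mass_le M : (forall r, 0 < r < T -> K r <= M) ->
  forall r, 0 < r < T -> w r <= M * d `^ (q - 1) / N * r `^ N.
Proof.
case: uw => _ _ wcv0 KM r rT; set c := M * _; rewrite -subr_ge0.
apply: (@nondecr_cvg0_ge0 R T (fun x => c / N * x `^ N - w x) w) rT => //.
- apply: (derive_ge0_nondecr (df := fun x =>
    c * x `^ (N - 1) - x `^ (N - 1) * K x * u x `^ (q - 1))) => s sT.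
    by apply: is_deriveB; [apply: dpow; case/andP: sT|exact: dw].
  case/andP: (sT) => s0 _.
  rewrite subr_ge0 [leRHS]mulrC -mulrA ler_wpM2l ?powR_ge0//.
  apply: ler_pM; rewrite ?powR_ge0 ?KM//; first by rewrite ltW// K_gt0.
  by rewrite ge0_ler_powR ?nnegrE ?(ltW q1) ?profile_le// ltW// u_gt0.
- move=> s /andP[s0 sT]; rewrite lerDr mulr_ge0 ?powR_ge0//.
  rewrite !mulr_ge0 ?powR_ge0 ?invr_ge0 ?(ltW N0)//.
  by apply: le_trans (KM s _); rewrite ?s0// ltW// K_gt0.
Qed.

(** The factor [2^-1] reflects the bound [u >= d / 2] close to 0. *)
Definition decay_const := K0 * 2^-1 `^ (q - 1) / N.

Lemma decay_const_gt0 : 0 < decay_const.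
Proof. by rewrite /decay_const; pos. Qed.

(** The ratio at [r] is at most its value at a point [s <= r] so close to 0 that [d / 2 <= u <= d]
    up to [s]. There [mass_ge] bounds [w] from below by a multiple of [s^N], and the powers of [s]
    cancel. *)
Lemma mass_ge_profile r : 0 < r < T ->
  decay_const * d `^ b * (r `^ N * u r `^ (N / L)) <= w r.
Proof.
move=> rT; have ur := u_gt0 rT; have wr := w_gt0 rT.
case/andP: (rT) => r0 rltT; have T0 := lt_trans r0 rltT.
have d20 : 0 < d / 2 by rewrite divr_gt0.
have [e e0 eu] : exists2 e, 0 < e & forall s, 0 < s < e -> d / 2 < u s.
  apply: near_right0_ex; case: uw => _ ud _; apply: (cvgr_gt _ ud).
  by rewrite ltr_pdivrMr// ltr_pMr// ltr1n.
set t := Num.min e T.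
have tT : t <= T by rewrite /t ge_min lexx orbT.
have t0 : 0 < t by rewrite lt_min e0.
have tu s : 0 < s < t -> d / 2 <= u s.
  by move=> /andP[s0]; rewrite lt_min => /andP[se _]; rewrite ltW// eu// s0.
set s := Num.min r (t / 2).
have sr : s <= r by rewrite /s ge_min lexx.
have s0 : 0 < s by rewrite lt_min r0 divr_gt0.
have st : s < t.
  by rewrite /s gt_min ltr_pdivrMr// ltr_pMr// ltr1n orbT.
have sT : 0 < s < T by rewrite s0 (lt_le_trans st).
have us := u_gt0 sT; have ws := w_gt0 sT.
have Hrs := decay_ratio_nonincr s0 sr rltT.
have := mass_ge (ltW d20) tT tu; move=> /(_ s); rewrite s0 st => /(_ isT) wsge.
have usd := profile_le sT.
set c := decay_const * d `^ b.
have c0 : 0 < c by have := decay_const_gt0; rewrite /c => ?; pos.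
have dE : c * (s `^ N * d `^ (N / L)) = K0 * (d / 2) `^ (q - 1) / N * s `^ N.
  rewrite /c /decay_const [(d / 2) `^ _]powRM ?invr_ge0 ?(ltW d0)//.
  have -> : d `^ (q - 1) = d `^ b * d `^ (N / L).
    by have [D ->] := pos_expR d0; exp_eq.
  by ring.
have Hs : decay_ratio u w s <= c^-1.
  rewrite /decay_ratio ler_pdivrMr// ler_pdivlMl//; apply: le_trans wsge.
  rewrite -dE ler_wpM2l ?(ltW c0)// ler_wpM2l ?powR_ge0//.
  by rewrite ge0_ler_powR ?nnegrE ?(ltW us) ?(ltW d0)//; pos.
rewrite -ler_pdivlMl// -ler_pdivrMr//.
exact: le_trans Hs.
Qed.

(** The hypothesis bounds [slope] from below by a multiple of [u^(1 + b)], so the resulting lower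
    bound on the derivative of [u^(-b)] no longer contains [u] and integrates to a power of [r]. *)
Lemma profile_powN_ge c : 0 < c ->
  (forall r, 0 < r < T -> c * (r `^ N * u r `^ (N / L)) <= w r) ->
  forall r, 0 < r < T -> c `^ a / L * r `^ p' <= u r `^ (- b).
Proof.
move=> c0 cw r rT; rewrite -subr_ge0.
apply: (@nondecr_cvg0_ge0 R T (fun x => u x `^ (- b) - c `^ a / L * x `^ p')
  (fun x => c `^ a / L * x `^ p')) rT.
- apply: (derive_ge0_nondecr (df := fun x => u x `^ (- b) *
    (- b * (- slope w x / u x)) - c `^ a / L * (p' * x `^ (p' - 1)))) => s sT.
    have us := u_gt0 sT; case/andP: (sT) => s0 _.
    have lu := log_derivePE (lt0r_neq0 us) (du sT).
    apply: is_deriveB; first exact: (log_derive_powR (- b) us lu).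
    by apply: (is_derive_eq (is_deriveZ (c `^ a / L) (is_derive1_powR p' s0))).
  have us := u_gt0 sT; have ws := w_gt0 sT; case/andP: (sT) => s0 _.
  set y := c * (s `^ N * u s `^ (N / L)).
  have yw : y `^ a <= w s `^ a.
    rewrite ge0_ler_powR ?nnegrE ?(ltW a0) ?(ltW ws) ?cw// /y; pos.
  have yE : u s `^ (- b) * (u s)^-1 * (y `^ a * s `^ (- (L + 1))) =
      c `^ a * s `^ (p' - 1).
    rewrite /y; have [U ->] := pos_expR us; have [C ->] := pos_expR c0.
    have [X ->] := pos_expR s0.
    by exp_eq.
  rewrite subr_ge0 (_ : _ * (p' * _) = b * (c `^ a * s `^ (p' - 1)));
    last first.
    by fieldp.
  rewrite -yE [leRHS](_ : _ = b * (u s `^ (- b) * (u s)^-1 * slope w s));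
    last first.
    by fieldp.
  rewrite ler_wpM2l ?(ltW b0)// ler_wpM2l ?mulr_ge0 ?powR_ge0 ?invr_ge0
    ?(ltW us)//.
  by rewrite /slope ler_wpM2r ?powR_ge0.
- by move=> s sT; rewrite lerDr powR_ge0.
- suff : c `^ a / L * x `^ p' @[x --> 0^'+] --> c `^ a / L * 0 by rewrite mulr0.
  by apply: cvgM; [exact: cvg_cst|exact: powR_cvg0].
Qed.

Definition profile_pow_const := (decay_const `^ a / L) `^ (- N).

(** The bubble bound on [u^(-b)] raised to the power [- N], with [b * N = q]. *)
Lemma profile_pow_le r : 0 < r < T ->
  u r `^ q <= profile_pow_const * (d `^ (- (q * a)) * r `^ (- (p' * N))).
Proof.
move=> rT; have c0 := decay_const_gt0.
have ur := u_gt0 rT; case/andP: (rT) => r0 _.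
have cd0 : 0 < decay_const * d `^ b by pos.
have := profile_powN_ge cd0 mass_ge_profile rT; set y := _ * r `^ p' => yu.
have y0 : 0 < y by rewrite /y; pos.
have -> : u r `^ q = ((u r `^ (- b)) `^ N)^-1.
  by rewrite -powRN -!powRrM; congr (_ `^ _); field.
have -> : profile_pow_const * (d `^ (- (q * a)) * r `^ (- (p' * N))) =
  (y `^ N)^-1.
  rewrite /y /profile_pow_const; have [C ->] := pos_expR c0;
    have [X ->] := pos_expR r0.
  have [D ->] := pos_expR d0; have [Y ->] := pos_expR L0.
  by exp_eq.
rewrite lef_pV2 ?posrE ?powR_gt0//.
by rewrite ge0_ler_powR ?nnegrE ?powR_ge0 ?(ltW N0) ?(ltW y0).
Qed.

(** * Behaviour at the scale [d^(-b)] and at a zero, for [K] bounded by [M] *)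

Section upper_bound.
Variable M : R.
Hypothesis K_le : forall r, 0 < r < T -> K r <= M.

Let slope_le r : 0 < r < T ->
  slope w r <= (M * d `^ (q - 1) / N) `^ a * r `^ (p' - 1).
Proof.
move=> rT; have wr := w_gt0 rT; case/andP: (rT) => r0 _.
have M0 : 0 < M by apply: lt_le_trans (K_le rT); exact: K_gt0.
set c := M * d `^ (q - 1) / N; have c0 : 0 < c by rewrite /c; pos.
have -> : c `^ a * r `^ (p' - 1) = (c * r `^ N) `^ a * r `^ (- (L + 1)).
  by have [C ->] := pos_expR c0; have [X ->] := pos_expR r0; exp_eq.
rewrite /slope ler_wpM2r ?powR_ge0// ge0_ler_powR ?nnegrE ?(ltW a0)
  ?(ltW wr) ?mass_le//.
by pos.
Qed.

Lemma profile_ge r : 0 < r < T ->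
  d - (M * d `^ (q - 1) / N) `^ a / p' * r `^ p' <= u r.
Proof.
move=> rT; set c := _ `^ a; rewrite -subr_ge0 opprB addrA.
apply: (@nondecr_cvg0_ge0 R T (fun x => u x + c / p' * x `^ p' - d)
  (fun x => d - u x)) rT.
- apply: (derive_ge0_nondecr (df := fun x =>
    - slope w x + c / p' * (p' * x `^ (p' - 1)) - 0)) => s sT; last first.
    rewrite subr0 addrC subr_ge0 mulrA divfK ?gt_eqF//.
    exact: slope_le.
  case/andP: (sT) => s0 _.
  apply: is_deriveB.
  apply: is_deriveD; first exact: du.
  by apply: (is_derive_eq (is_deriveZ (c / p') (is_derive1_powR p' s0))).
- by move=> s sT; rewrite opprB lerD2r lerDl /c; pos.
- case: uw => _ ud _.
  by rewrite -[X in _ --> X](subrr d); apply: cvgB => //; exact: cvg_cst.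
Qed.

(** Chosen so that at radius [half_radius * d^(-b)] the loss allowed by [profile_ge] is exactly
    [d / 2]; the powers of [d] combine because [(q - 1) * a - b * p' = 1]. *)
Definition half_radius := (2 * ((M / N) `^ a / p')) `^ (- p'^-1).

Lemma profile_ge_half r : 0 < r < T -> r <= half_radius * d `^ (- b) ->
  d / 2 <= u r.
Proof.
move=> rT rs; case/andP: (rT) => r0 _; apply: le_trans (profile_ge rT).
have M0 : 0 < M by apply: lt_le_trans (K_le rT); exact: K_gt0.
have A0 : 0 < (M / N) `^ a / p' by pos.
rewrite lerBrDr -lerBrDl.
have -> : d - d / 2 = d / 2 by field.
apply: (@le_trans _ _ ((M / N) `^ a / p' * d `^ ((q - 1) * a) *
    (half_radius * d `^ (- b)) `^ p')); last first.
  rewrite /half_radius; set A := _ / p' in A0 *.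
  have [D ->] := pos_expR d0; have [Y ->] := pos_expR A0.
  have two0 : 0 < 2 :> R by [].
  have [W ->] := pos_expR two0.
  rewrite le_eqVlt; apply/orP; left; apply/eqP; exp_eq.
have -> : M * d `^ (q - 1) / N = M / N * d `^ (q - 1) by rewrite mulrAC.
rewrite powRM ?powR_ge0//; last by pos.
rewrite -powRrM [_ * _ / p']mulrAC ler_wpM2l//; first by pos.
by rewrite ge0_ler_powR ?nnegrE ?(ltW p'0) ?(ltW r0)// /half_radius; pos.
Qed.

Hypothesis T0 : 0 < T.
Hypothesis u_T : u r @[r --> T^'-] --> 0.

Let M_gt0 : 0 < M.
Proof.
have T2 : 0 < T / 2 by rewrite divr_gt0.
apply: lt_le_trans (K_gt0 T2) (K_le _).
by rewrite T2 ltr_pdivrMr// ltr_pMr// ltr1n.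
Qed.

Let half_radius_gt0 : 0 < half_radius * d `^ (- b).
Proof. by rewrite /half_radius; have := M_gt0 => ?; pos. Qed.

(** Otherwise [u >= d / 2] would hold all the way to [T], where [u] tends to 0. *)
Lemma half_radius_lt : half_radius * d `^ (- b) < T.
Proof.
rewrite ltNge; apply/negP => Tle.
have d20 : 0 < d / 2 by rewrite divr_gt0.
have u_lt : \forall r \near T^'-, u r < d / 2 by apply: (cvgr_lt _ u_T).
suff : d / 2 < d / 2 by rewrite ltxx.
near (T^'-) => r.
have rT : r < T by near: r; exact: nbhs_left_lt.
apply: (@le_lt_trans _ _ (u r)); last by near: r.
apply: profile_ge_half; last exact: le_trans (ltW rT) Tle.
by rewrite rT andbT; near: r; exact: nbhs_left_gt.
Unshelve. all: end_near. Qed.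

Definition mass_const := decay_const * (half_radius / 2) `^ N.

(** Before the radius [s] the profile is at least [d / 2], so [w (s / 2)] has order
    [d^(q - 1) * d^(-b * N) = 1 / d], and [w] is nondecreasing. The point [s / 2] lies strictly
    inside the interval, as [mass_ge] demands. *)
Lemma mass_ge_const r : half_radius * d `^ (- b) <= r -> r < T ->
  mass_const / d <= w r.
Proof.
move=> rs rT; set s := half_radius * d `^ (- b) in rs.
have s0 : 0 < s := half_radius_gt0.
have s2s : s / 2 < s by rewrite ltr_pdivrMr// ltr_pMr// ltr1n.
have s20 : 0 < s / 2 by rewrite divr_gt0.
have sT : s <= T := ltW half_radius_lt.
apply: le_trans (mass_nondecr s20 (le_trans (ltW s2s) rs) rT).
have d20 : 0 < d / 2 by rewrite divr_gt0.
have us t : 0 < t < s -> d / 2 <= u t.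
  by move=> /andP[t0 ts];
    rewrite profile_ge_half ?(ltW ts)// t0 (lt_le_trans ts).
have s2 : 0 < s / 2 < s by rewrite s20.
apply: le_trans (mass_ge (ltW d20) sT us s2).
have h0 : 0 < half_radius.
  by move: s0; rewrite /s pmulr_lgt0// powR_gt0.
rewrite /mass_const /decay_const /s le_eqVlt; apply/orP; left; apply/eqP.
rewrite [LHS](_ : _ = K0 / N * (2^-1 `^ (q - 1) *
  (half_radius / 2) `^ N / d)); last by ring.
rewrite [RHS](_ : _ = K0 / N * ((d / 2) `^ (q - 1) * (half_radius *
  d `^ (- b) / 2) `^ N)); last by ring.
congr (_ * _).
have two0 : 0 < 2 :> R by [].
have [D ->] := pos_expR d0; have [Y ->] := pos_expR h0.
by have [W ->] := pos_expR two0; exp_eq.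
Qed.

(** * Upper bounds on the Pohozaev function from a power bound on [dK] *)

Section derivative_bound.
Variables C l : R.
Hypotheses (C0 : 0 < C) (l0 : 0 < l).
Hypothesis dK_le : forall r, 0 < r < T -> dK r <= C * r `^ (l - 1).

Let dpohozaev_le Y r : 0 < r < T -> u r `^ q <= Y ->
  (N - p) / (N * p) * (dK r * (r `^ N * u r `^ q)) <=
  (N - p) / (N * p) * (C * (r `^ (N + l - 1) * Y)).
Proof.
move=> rT uY; have ur := u_gt0 rT; case/andP: (rT) => r0 _.
rewrite ler_wpM2l//; first by pos.
have -> : r `^ (N + l - 1) = r `^ (l - 1) * r `^ N.
  by have [X ->] := pos_expR r0; exp_eq.
rewrite [leRHS](_ : _ = C * r `^ (l - 1) * (r `^ N * Y)); last by ring.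
rewrite ler_pM ?dK_ge0 ?dK_le//; first by pos.
by rewrite ler_wpM2l ?powR_ge0.
Qed.

Let pohozaev_le_small r : 0 < r < T ->
  pohozaev u w r <= (N - p) / (N * p) * (C * (d `^ q / (N + l))) * r `^ (N + l).
Proof.
move=> rT; have M0 : 0 < M.
  by case/andP: (rT) => r0 _; apply: lt_le_trans (K_le rT); exact: K_gt0.
set c := _ * (C * _); rewrite -subr_ge0.
set c1 := M * d `^ (q - 1) / N.
have c10 : 0 < c1 by rewrite /c1; pos.
have Nl0 : 0 < N + l by pos.
apply: (@nondecr_cvg0_ge0 R T (fun x => c * x `^ (N + l) - pohozaev u w x)
  (fun x => (p - 1) / p * (c1 * x `^ N * (c1 `^ a * x `^ p'))
    + (N - p) / (N * p) * (M * (x `^ N * d `^ q)))) rT.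
- apply: (derive_ge0_nondecr (df := fun x => c * ((N + l) * x `^ (N + l - 1)) -
   (N - p) / (N * p) * (dK x * (x `^ N * u x `^ q)))) => s sT; last first.
    have usd : u s `^ q <= d `^ q.
      by rewrite ge0_ler_powR ?nnegrE ?(ltW q0)
        ?(ltW d0) ?profile_le// ltW// u_gt0.
    rewrite subr_ge0; apply: le_trans (dpohozaev_le sT usd) _.
    by rewrite /c le_eqVlt; apply/orP; left; apply/eqP; fieldp.
  case/andP: (sT) => s0 _.
  apply: is_deriveB; last exact: pohozaev_derive.
  by apply: (is_derive_eq (is_deriveZ c (is_derive1_powR (N + l) s0))).
(* The two positive terms of [pohozaev] are dominated by powers of [s] that vanish at 0; the
   negative one is dropped. *)
- move=> s sT; have us := u_gt0 sT; have ws := w_gt0 sT;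
    have ss := slope_gt0 sT.
  case/andP: (sT) => s0 _.
  rewrite lerNl opprB; apply: ler_wnDr; first by rewrite oppr_le0 /c; pos.
  rewrite /pohozaev lerD//.
    apply: ler_wnDr; first by rewrite oppr_le0; pos.
    rewrite ler_wpM2l ?divr_ge0 ?(ltW p1_gt0) ?(ltW p0)//.
    rewrite mulrAC [_ * w s]mulrC ler_pM ?mass_le//; [pos|pos|].
    rewrite -(mulr_powRB1 (ltW s0) p'0) [leRHS]mulrCA ler_wpM2l ?(ltW s0)//.
    exact: slope_le.
  have Ks := K_gt0 s0; apply: ler_wpM2l; first by pos.
  apply: ler_pM; [pos|pos|exact: K_le|].
  rewrite ler_wpM2l ?powR_ge0//.
  by rewrite ge0_ler_powR ?nnegrE ?(ltW q0) ?(ltW d0) ?profile_le// ltW// u_gt0.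
- suff : (p - 1) / p * (c1 * x `^ N * (c1 `^ a * x `^ p'))
    + (N - p) / (N * p) * (M * (x `^ N * d `^ q)) @[x --> 0^'+] -->
    (p - 1) / p * (c1 * 0 * (c1 `^ a * 0)) + (N - p) / (N * p) * (M * (0 *
      d `^ q)).
    by rewrite !(mulr0, mul0r) addr0.
  have xN : x `^ N @[x --> 0^'+] --> (0 : R) by exact: powR_cvg0.
  have xp : x `^ p' @[x --> 0^'+] --> (0 : R) by exact: powR_cvg0.
  by apply: cvgD; repeat (apply: cvgM); try exact: cvg_cst.
Qed.

Hypothesis l_lt : l < N / (p - 1).

Let Nlp_n0 : N + - l * (p - 1) != 0.
Proof. by rewrite mulNr subr_eq0 gt_eqF// -ltr_pdivlMr. Qed.

(** The bubble bound makes the derivative at most a multiple of [x^(l - N / (p - 1) - 1)]. The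
    exponent [l - N / (p - 1)] is negative, so the integral beyond [s] stays bounded in [r]. *)
Let pohozaev_le_large r s : 0 < s -> s <= r -> r < T -> pohozaev u w r <=
  pohozaev u w s + (N - p) / (N * p) *
    (C * (profile_pow_const * d `^ (- (q * a)) / (N / (p - 1) - l))) *
    s `^ (l - N / (p - 1)).
Proof.
move=> s0 sr rT; set c := _ * (C * _); set e := l - _.
have r0 := lt_le_trans s0 sr.
have e0 : N / (p - 1) - l != 0 by rewrite subr_eq0 gt_eqF.
have up0 : 0 < profile_pow_const by have := decay_const_gt0;
  rewrite /profile_pow_const => ?; pos.
have c0 : 0 <= c.
  have e1 : 0 < N / (p - 1) - l by rewrite subr_gt0.
  by rewrite /c; pos.
suff : pohozaev u w r + c * r `^ e <= pohozaev u w s + c * s `^ e.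
  by apply: le_trans; rewrite lerDl mulr_ge0 ?powR_ge0.
move: s0 sr rT; apply: (derive_le0_nonincr
  (f := fun x => pohozaev u w x + c * x `^ e)
  (df := fun x => (N - p) / (N * p) * (dK x * (x `^ N * u x `^ q)) +
   c * (e * x `^ (e - 1)))) => x xT.
  apply: is_deriveD; first exact: pohozaev_derive.
  case/andP: (xT) => x0 _.
  by apply: (is_derive_eq (is_deriveZ c (is_derive1_powR e x0))).
rewrite -[X in _ + X]opprK subr_le0.
apply: le_trans (dpohozaev_le xT (profile_pow_le xT)) _.
case/andP: (xT) => x0 _.
have -> : x `^ (e - 1) = x `^ (N + l - 1) * x `^ (- (p' * N)).
  by rewrite /e; have [X ->] := pos_expR x0; exp_eq.
by rewrite /c /e le_eqVlt; apply/orP; left; apply/eqP; fieldp.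
Qed.

Definition pohozaev_const := (N - p) / (N * p) *
  (C * (1 / (N + l) + profile_pow_const / (N / (p - 1) - l))).

(** At the radius [s = d^(-b)] the bound with [u <= d] and the tail bound both have order
    [d^(-b * l)], again by [b * N = q]. *)
Lemma pohozaev_le r : 0 < r < T ->
  pohozaev u w r <= pohozaev_const * d `^ (- (b * l)).
Proof.
move=> rT; case/andP: (rT) => r0 rltT.
have e1 : 0 < N / (p - 1) - l by rewrite subr_gt0.
have up0 : 0 < profile_pow_const by have := decay_const_gt0;
  rewrite /profile_pow_const => ?; pos.
set s := d `^ (- b); have s0 : 0 < s by rewrite /s; pos.
have small t : 0 < t < T -> t <= s -> pohozaev u w t <=
    (N - p) / (N * p) * (C * (1 / (N + l))) * d `^ (- (b * l)).
  move=> tT ts; apply: le_trans (pohozaev_le_small tT) _.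
  case/andP: (tT) => t0 _; have Nl0 : 0 < N + l by pos.
  have -> : d `^ (- (b * l)) = d `^ q * s `^ (N + l).
    by rewrite /s; have [D ->] := pos_expR d0; exp_eq.
  rewrite [leRHS](_ : _ =
    (N - p) / (N * p) * (C * (d `^ q / (N + l))) * s `^ (N + l));
      last by fieldp.
  rewrite ler_wpM2l//; first by pos.
  by rewrite ge0_ler_powR ?nnegrE ?(ltW Nl0) ?(ltW t0) ?(ltW s0).
rewrite /pohozaev_const !mulrDr mulrDl.
have [rs|sr] := leP r s.
  by apply: ler_wpDr (small _ rT rs); pos.
have sT : 0 < s < T by rewrite s0 (lt_trans sr).
apply: le_trans (pohozaev_le_large s0 (ltW sr) rltT) _.
rewrite lerD ?small// le_eqVlt; apply/orP; left; apply/eqP.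
have -> : d `^ (- (b * l)) = d `^ (- (q * a)) * s `^ (l - N / (p - 1)).
  by rewrite /s; have [D ->] := pos_expR d0; exp_eq.
by have e0 := lt0r_neq0 e1; fieldp.
Qed.

Definition zero_const :=
  p / (p - 1) * (pohozaev_const * mass_const `^ (- p')).

Lemma zero_powN_le : T `^ (- L) <= zero_const * d `^ (b * (L - l)).
Proof.
have h0 := M_gt0.
have mc0 : 0 < mass_const.
  by have := decay_const_gt0; rewrite /mass_const /half_radius => ?; pos.
set m := (mass_const / d) `^ p'.
have m0 : 0 < m by rewrite /m; pos.
suff : (p - 1) / p * (m * T `^ (- L)) <= pohozaev_const * d `^ (- (b * l)).
  rewrite -ler_pdivlMl; last by pos.
  rewrite -ler_pdivlMl// => /le_trans; apply.
  rewrite le_eqVlt; apply/orP; left; apply/eqP.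
  rewrite /zero_const /m [LHS](_ : _ = p / (p - 1) * pohozaev_const *
   (((mass_const / d) `^ p')^-1 * d `^ (- (b * l)))); last by fieldp.
  rewrite [RHS](_ : _ = p / (p - 1) * pohozaev_const *
    (mass_const `^ (- p') * d `^ (b * (L - l)))); last by ring.
  congr (_ * _); have [D ->] := pos_expR d0; have [Y ->] := pos_expR mc0;
    exp_eq.
(* [w] is not controlled at [T] itself, so the passage to the limit is a contradiction: a positive
   gap [X] would be at most [(N - p) / p * (u r * w r)] for [r] near [T], and this tends to 0
   because [w] is bounded by [mass_le]. *)
rewrite leNgt -subr_gt0; set X := _ - _; apply/negP => X0.
set c := (N - p) / p * (M * d `^ (q - 1) / N * T `^ N).
have c0 : 0 < c by rewrite /c; pos.
have u_lt : \forall r \near T^'-, u r < X / c.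
  by apply: (cvgr_lt _ u_T); exact: divr_gt0.
suff : X < X by rewrite ltxx.
near (T^'-) => r.
have rltT : r < T by near: r; exact: nbhs_left_lt.
have rs : half_radius * d `^ (- b) <= r.
  by near: r; exact: nbhs_left_ge half_radius_lt.
have rT : 0 < r < T by rewrite rltT andbT; exact: lt_le_trans rs.
have r0 : 0 < r by case/andP: rT.
have urX : u r < X / c by near: r.
have ur := u_gt0 rT; have wr := w_gt0 rT; have Kr := K_gt0 r0.
have PX : X <= (N - p) / p * (u r * w r).
  rewrite /X lerBlDr -lerBlDl.
  apply: le_trans (pohozaev_le rT); rewrite /pohozaev.
  apply: ler_wpDr; first by pos.
  rewrite lerD2r; apply: ler_wpM2l; first by pos.
  have -> : r * w r * slope w r = w r `^ p' * r `^ (- L).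
    rewrite /slope; have [W ->] := pos_expR wr; have [Y ->] := pos_expR r0;
      exp_eq.
  apply: ler_pM; [pos|pos| |].
    rewrite /m ge0_ler_powR ?nnegrE ?(ltW p'0) ?(ltW wr) ?mass_ge_const//; pos.
  rewrite !powRN lef_pV2 ?posrE ?powR_gt0//.
  by rewrite ge0_ler_powR ?nnegrE ?(ltW L0) ?(ltW rltT) ?(ltW r0) ?(ltW T0).
apply: le_lt_trans PX _; apply: (@le_lt_trans _ _ (u r * c)); last first.
  by rewrite -ltr_pdivlMr.
rewrite mulrCA ler_wpM2l ?(ltW ur)// /c ler_wpM2l//; first by pos.
apply: le_trans (mass_le K_le rT) _; rewrite ler_wpM2l//; first by pos.
by rewrite ge0_ler_powR ?nnegrE ?(ltW N0) ?(ltW rltT) ?(ltW r0) ?(ltW T0).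
Unshelve. all: end_near. Qed.

End derivative_bound.
End upper_bound.

End identities.

(** * Nonexistence of a positive global solution *)

Section global_profile.
Variables (d : R) (u w : R -> R).
Hypothesis d0 : 0 < d.
Hypothesis uw : forall T, radial_profile d T u w.

Let rT r : 0 < r -> 0 < r < r + 1.
Proof. by move=> ->; rewrite /= ltrDl. Qed.
Let u_gt0 r : 0 < r -> 0 < u r.
Proof. by move=> /rT; case: (uw (r + 1)) => h _ _ /h[]. Qed.
Let w_gt0 r : 0 < r -> 0 < w r.
Proof. by move=> /rT; case: (uw (r + 1)) => h _ _ /h[]. Qed.
Let du r : 0 < r -> is_derive r 1 u (- slope w r).
Proof. by move=> /rT; case: (uw (r + 1)) => h _ _ /h[]. Qed.

(** Beyond [r] the mass is at least [w r], so [g = u - A x^(-L)] is nonincreasing there. It also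
    exceeds [- A x^(-L)], which tends to 0, so it never becomes negative. *)
Lemma global_profile_ge r s : 0 < r -> r < s ->
  w r `^ a / L * s `^ (- L) <= u s.
Proof.
move=> r0 rs; set A := _ / L; set g := fun x => u x - A * x `^ (- L).
have A0 : 0 < A by have := w_gt0 r0 => ?; rewrite /A; pos.
have s0 := lt_trans r0 rs.
rewrite -subr_ge0 -[_ - _]/(g s) leNgt; apply/negP => gs.
(* From this radius on, [g > - A x^(-L) >= g s]. *)
pose y := (- g s / A) `^ (- L^-1).
have X0 : 0 < - g s / A by rewrite divr_gt0// oppr_gt0.
have y0 : 0 < y by exact: powR_gt0.
have yE : A * y `^ (- L) = - g s.
  rewrite /y -powRrM (_ : - L^-1 * - L = 1); last by fieldp.
  by rewrite powRr1 ?(ltW X0)// mulrC divfK// gt_eqF.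
pose t := Num.max s y.
have st : s <= t by rewrite /t le_max lexx.
have t0 := lt_le_trans s0 st.
have yt : y <= t by rewrite /t le_max lexx orbT.
suff : g t <= g s.
  apply/negP; rewrite -ltNge /g.
  have ut := u_gt0 t0.
  apply: (@le_lt_trans _ _ (- (A * t `^ (- L)))); last by rewrite ltrDr.
  rewrite -/(g s) lerNr -yE ler_wpM2l
    ?(ltW A0)// !powRN lef_pV2 ?posrE ?powR_gt0//.
  by rewrite ge0_ler_powR ?nnegrE ?(ltW L0) ?(ltW y0) ?(ltW t0).
apply: (@derive_le0_nonincr R r (t + 1) g (fun x =>
  - slope w x - A * (- L * x `^ (- L - 1)))) => //.
- move=> x /andP[rx _]; have x0 := lt_trans r0 rx.
  apply: is_deriveB; first exact: du.
  by apply: (is_derive_eq (is_deriveZ A (is_derive1_powR (- L) x0))).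
- move=> x /andP[rx xt]; have x0 := lt_trans r0 rx.
  rewrite mulNr mulrN opprK addrC subr_le0 mulrA divfK ?gt_eqF// /slope opprD.
  rewrite ler_wpM2r ?powR_ge0// ge0_ler_powR ?nnegrE ?(ltW a0)
    ?(ltW (w_gt0 _))//.
  exact: (mass_nondecr (uw (t + 1)) r0 (ltW rx)).
- by rewrite ltrDl.
Qed.

Lemma no_global_profile s0 t0 : 0 < s0 -> s0 < t0 -> K s0 < K t0 -> False.
Proof.
move=> s00 st0 Kst; have t00 := lt_trans s00 st0.
have [c c0 cP] : exists2 c, 0 < c & forall r, t0 <= r -> c <= pohozaev u w r.
  exists (pohozaev u w t0) => [|r t0r]; last first.
    by apply: (pohozaev_nondecr (uw (r + 1)) t00 t0r); rewrite ltrDl.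
  have t10 : 0 < t0 + 1 by pos.
  have u1 := u_gt0 t10; have s20 : 0 < s0 / 2 by pos.
  (* A lower bound for the factor of [dK] in the derivative of [pohozaev] on an open interval around
     [[s0, t0]]; hence [pohozaev] gains at least [k * (K t0 - K s0)]. *)
  pose k := (N - p) / (N * p) * ((s0 / 2) `^ N * u (t0 + 1) `^ q).
  have k0 : 0 < k by rewrite /k; pos.
  have : pohozaev u w s0 - k * K s0 <= pohozaev u w t0 - k * K t0.
    apply: (@derive_ge0_nondecr R (s0 / 2) (t0 + 1)
     (fun x => pohozaev u w x - k * K x)
     (fun x => (N - p) / (N * p) * (dK x * (x `^ N * u x `^ q)) - k * dK x)).
    - move=> x /andP[sx xt]; have x0 := lt_trans s20 sx.
      apply: is_deriveB; last exact: (is_deriveZ k (dKE x0)).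
      by apply: (pohozaev_derive (uw (t0 + 1))); rewrite x0.
    - move=> x /andP[sx xt]; have x0 := lt_trans s20 sx; have ux := u_gt0 x0.
      have dKx := dK_ge0 x0.
      rewrite subr_ge0 /k -mulrA ler_wpM2l//; first by pos.
      rewrite mulrC ler_wpM2l// ler_pM ?powR_ge0//.
        by rewrite ge0_ler_powR ?nnegrE ?(ltW N0) ?(ltW x0) ?(ltW sx)
          ?(ltW s20).
      rewrite ge0_ler_powR ?nnegrE ?(ltW q0) ?(ltW ux) ?(ltW u1)//.
      by apply: (profile_nonincr (uw (t0 + 2)) x0 (ltW xt));
        rewrite ltrD2l ltr1n.
    - by rewrite ltr_pdivrMr// ltr_pMr// ltr1n.
    - exact: ltW.
    - by rewrite ltrDl.
  have Ps : 0 <= pohozaev u w s0 by apply: (pohozaev_ge0 (uw (s0 + 1)));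
    exact: rT.
  have : 0 < k * (K t0 - K s0) by rewrite mulr_gt0// subr_gt0.
  rewrite mulrBr; lra.
have [C1 C10 uC] : exists2 C, 0 < C & forall r, 0 < r -> u r <= C * r `^ (- L).
  have B0 : 0 < profile_pow_const * d `^ (- (q * a)).
    have := decay_const_gt0 => ?; rewrite /profile_pow_const; pos.
  exists ((profile_pow_const * d `^ (- (q * a))) `^ q^-1) => [|r r0];
    first by pos.
  have := profile_pow_le d0 (uw (r + 1)) (rT r0); rewrite mulrA => h.
  have -> : u r = (u r `^ q) `^ q^-1.
    by rewrite -powRrM mulfV ?gt_eqF// powRr1// ltW// u_gt0.
  have -> : r `^ (- L) = (r `^ (- (p' * N))) `^ q^-1.
    by rewrite -powRrM; congr (_ `^ _); fieldp.
  rewrite -powRM ?powR_ge0 ?(ltW B0)//.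
  by rewrite ge0_ler_powR ?nnegrE ?powR_ge0 ?invr_ge0
    ?(ltW q0)// mulr_ge0 ?powR_ge0 ?(ltW B0).
(* At [2 * r] the lower bound of [global_profile_ge] meets the upper bound [uC]; the common factor
   [(2 * r)^(-L)] cancels. *)
have [W W0 wW] : exists2 W, 0 < W & forall r, 0 < r -> w r <= W.
  exists ((L * C1) `^ (p - 1)) => [|r r0]; first by pos.
  have r20 : 0 < 2 * r by rewrite mulr_gt0.
  have r2 : r < 2 * r by rewrite ltr_pMl// ltr1n.
  have := le_trans (global_profile_ge r0 r2) (uC _ r20).
  rewrite ler_pM2r ?powR_gt0// ler_pdivrMr// [C1 * L]mulrC => h.
  have wr := w_gt0 r0.
  have -> : w r = (w r `^ a) `^ (p - 1).
    by rewrite -powRrM mulVf// powRr1// ltW.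
  by rewrite ge0_ler_powR ?nnegrE ?powR_ge0 ?(ltW p1_gt0)// mulr_ge0// ltW.
have wt0 := w_gt0 t00.
have [h h0 hH] : exists2 h, 0 < h & forall r, t0 < r -> h <= decay_ratio u w r.
  exists ((w t0 `^ a / L) `^ (N / L) / W) => [|r t0r]; first by pos.
  have r0 := lt_trans t00 t0r; have wr := w_gt0 r0; have ur := u_gt0 r0.
  have A0 : 0 < w t0 `^ a / L by pos.
  have NL0 : 0 < N / L by exact: divr_gt0.
  apply: (@le_trans _ _ ((w t0 `^ a / L) `^ (N / L) / w r)).
    by apply: ler_wpM2l; [pos|rewrite lef_pV2 ?posrE// wW].
  rewrite /decay_ratio ler_wpM2r ?invr_ge0 ?(ltW wr)//.
  have -> : (w t0 `^ a / L) `^ (N / L) =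
      r `^ N * (w t0 `^ a / L * r `^ (- L)) `^ (N / L).
    by have [Y ->] := pos_expR A0; have [X ->] := pos_expR r0; exp_eq.
  rewrite ler_wpM2l ?powR_ge0// ge0_ler_powR ?nnegrE ?(ltW NL0) ?(ltW ur)//.
    by pos.
  exact: global_profile_ge.
(* With the four bounds just obtained, the derivative of the ratio is at most [- k * x^(L - 1)], so
   [f] is nonincreasing beyond [t0]. *)
pose k := q * h * c / (W * C1).
have k0 : 0 < k by rewrite /k; pos.
pose f x := decay_ratio u w x + k / L * x `^ L.
have t20 : 0 < 2 * t0 by pos.
have f20 : 0 < f (2 * t0).
  by have := u_gt0 t20 => ?; have := w_gt0 t20 => ?; rewrite /f /decay_ratio;
    pos.
(* Here the term [k / L * r^L] alone equals [f (2 * t0)], and the positive ratio makes [f r]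
   strictly larger. *)
pose r := (f (2 * t0) / (k / L)) `^ L^-1.
have rE : k / L * r `^ L = f (2 * t0).
  have kL : 0 < k / L by exact: divr_gt0.
  rewrite /r -powRrM mulVf ?gt_eqF// powRr1; last exact/ltW/divr_gt0.
  by rewrite mulrC divfK// gt_eqF.
have r0 : 0 < r by rewrite /r; pos.
have t2r : 2 * t0 <= r.
  rewrite leNgt; apply/negP => rlt.
  have := gt0_ltr_powR L0; move=> /(_ r (2 * t0)).
  rewrite !nnegrE (ltW r0) (ltW t20) => /(_ isT isT rlt).
  rewrite -(ltr_pM2l (divr_gt0 k0 L0)) rE ltNge => /negP; apply.
  by have := u_gt0 t20 => ?; have := w_gt0 t20 => ?;
    rewrite /f lerDr /decay_ratio; pos.
have t2 : t0 < 2 * t0 by rewrite ltr_pMl// ltr1n.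
have ur := u_gt0 r0; have wr := w_gt0 r0.
suff : f r <= f (2 * t0).
  by rewrite {1}/f rE gerDr; apply/negP; rewrite -ltNge /decay_ratio; pos.
apply: (@derive_le0_nonincr R t0 (r + 1) f (fun x =>
  - (q * decay_ratio u w x * pohozaev u w x / (x * (u x * w x))) +
  k / L * (L * x `^ (L - 1)))) => //.
- move=> x /andP[tx xr]; have x0 := lt_trans t00 tx.
  apply: is_deriveD; first by apply: (decay_ratio_derive (uw (r + 1)));
    rewrite x0.
  by apply: (is_derive_eq (is_deriveZ (k / L) (is_derive1_powR L x0))).
- move=> x /andP[tx xr]; have x0 := lt_trans t00 tx.
  have ux := u_gt0 x0; have wx := w_gt0 x0.
  rewrite addrC subr_le0 mulrA divfK ?gt_eqF//.
  have -> : k * x `^ (L - 1) = q * h * c / (x * (C1 * x `^ (- L) * W)).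
    rewrite powRN (@powRB _ x L 1) ?(gt_eqF x0) ?implybT// powRr1
      ?(ltW x0)// /k.
    have xL := powR_gt0 L x0.
    by fieldp.
  apply: ler_pM; [pos|pos| |].
    apply: ler_pM; [pos|pos| |by rewrite cP// ltW].
    by rewrite ler_wpM2l ?(ltW q0) ?hH.
  rewrite lef_pV2 ?posrE; [|pos|pos].
  by rewrite ler_wpM2l ?(ltW x0)// ler_pM ?uC ?wW// ltW.
- by rewrite ltrDl.
Qed.

End global_profile.
End profile.
End radial.

(** * From regular solutions to the first-order system *)

Section regular.
Variables (R : realType) (n : nat) (p : R) (K v : R -> R) (d : R).
Hypotheses (p_gt1 : 1 < p) (p_ltN : p < n%:R).
Implicit Types (r s x y : R).
Hypothesis K_gt0 : forall r, 0 < r -> 0 < K r.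
Hypothesis v_sol : regular_solution n p K d v.
Local Notation N := (n%:R : R).
Local Notation L := ((N - p) / (p - 1)).
Local Notation q := (N * p / (N - p)).
Local Notation phi := (flux n p v).

Let N_gt0 : (0 < n)%N.
Proof. by rewrite -(ltr_nat R); move: p_gt1 p_ltN => /= ? ?; lra. Qed.
Let p1_gt0 : 0 < p - 1. Proof. by rewrite subr_gt0. Qed.
Let a0 : 0 < (p - 1)^-1. Proof. by rewrite invr_gt0. Qed.
Let L0 : 0 < L. Proof. by rewrite divr_gt0// subr_gt0. Qed.
Let p1n0 : p - 1 != 0. Proof. by rewrite subr_eq0 gt_eqF. Qed.

Let powE r : 0 < r -> r ^+ n.-1 = r `^ (N - 1).
Proof.
move=> r0; rewrite -powR_mulrn ?(ltW r0)//; congr (_ `^ _).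
by rewrite -[in RHS](prednK N_gt0) -natr1 addrK.
Qed.

Let dv r : 0 < r -> is_derive r 1 v (derive1 v r).
Proof.
by case: v_sol => h _ /h[vd _ _]; rewrite derive1E; exact: derivableP.
Qed.

Lemma flux_gt0_derive r : 0 < r -> 0 < phi r ->
  derive1 v r = slope n%:R p phi r.
Proof.
move=> r0 fr; have rN : 0 < r `^ (N - 1) by exact: powR_gt0.
have := @signed_pow_inv R p (derive1 v r) (phi r / r `^ (N - 1)) p_gt1.
rewrite divr_gt0// => /(_ isT) ->; last first.
  by rewrite /flux powE// mulrAC mulfV ?mul1r// gt_eqF.
by rewrite /slope; have [F ->] := pos_expR fr; have [X ->] := pos_expR r0;
  exp_eq.
Qed.

Lemma flux_lt0_derive r : 0 < r -> phi r < 0 ->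
  derive1 v r = - slope n%:R p (fun x => - phi x) r.
Proof.
rewrite -oppr_gt0 => r0 fr; have rN : 0 < r `^ (N - 1) by exact: powR_gt0.
have := @signed_pow_inv R p (- derive1 v r) (- phi r / r `^ (N - 1)) p_gt1.
rewrite divr_gt0// => /(_ isT) E; rewrite -[LHS]opprK E; last first.
  by rewrite signed_powN /flux powE// mulNr mulrAC mulfV ?mul1r// gt_eqF.
rewrite /slope /=; set F := - phi r in fr *.
by congr (- _); have [X ->] := pos_expR r0; have [Y ->] := pos_expR fr; exp_eq.
Qed.

Section positive.
Variable T : R.
Hypothesis v_gt0 : forall r, 0 < r < T -> 0 < v r.

Let dphi r : 0 < r < T ->
  is_derive r 1 phi (- (r `^ (N - 1) * K r * v r `^ (q - 1))).
Proof.
move=> rT; have vr := v_gt0 rT; case/andP: rT => r0 _.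
case: v_sol => h _; have [_ fd /eqP] := h r r0.
rewrite powE// signed_pow_gt0// addr_eq0 => /eqP <-.
by rewrite derive1E; exact: derivableP.
Qed.

Let dphi_lt0 r : 0 < r < T -> - (r `^ (N - 1) * K r * v r `^ (q - 1)) < 0.
Proof.
move=> rT; have vr := v_gt0 rT; case/andP: rT => r0 _; have Kr := K_gt0 r0.
by rewrite oppr_lt0; pos.
Qed.

Let phi_decr r s : 0 < r -> r < s -> s < T -> phi s < phi r.
Proof. exact: (derive_lt0_decr dphi dphi_lt0). Qed.

Let dpowL A r : 0 < r -> is_derive r 1 (fun x => A / L * x `^ (- L))
  (- (A * r `^ (- (L + 1)))).
Proof.
move=> r0; apply: (is_derive_eq (is_deriveZ (A / L)
  (is_derive1_powR (- L) r0))).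
rewrite /GRing.scale /= mulrA mulrN divfK ?gt_eqF// opprD.
by rewrite mulNr.
Qed.

Let half r : 0 < r -> 0 < r / 2 < r.
Proof. by move=> r0; rewrite divr_gt0//= ltr_pdivrMr// ltr_pMr// ltr1n. Qed.

(** The flux decreases, so if it were nonnegative at [r] it would be at least [phi (r / 2) > 0] down
    to 0. Then [v'] would dominate [A x^(-L - 1)], forcing [v] to minus infinity at 0 against its
    positivity. *)
Lemma flux_lt0 r : 0 < r < T -> phi r < 0.
Proof.
move=> /andP[r0 rT]; rewrite ltNge; apply/negP => fr.
case/andP: (half r0) => s0 sr; set s := r / 2 in s0 sr;
  have sT := lt_trans sr rT.
have fs : 0 < phi s := le_lt_trans fr (phi_decr s0 sr rT).
pose A := phi s `^ (p - 1)^-1.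
have A0 : 0 < A by exact: powR_gt0.
case/andP: (half s0) => t0 ts; set t := s / 2 in t0 ts.
pose g x := v x + A / L * x `^ (- L).
have [x /andP[x0 xt]] := powRN_unbounded (g t) (divr_gt0 A0 L0) L0 t0.
apply/negP; rewrite -leNgt.
have vx : 0 < v x by rewrite v_gt0// x0 (lt_trans xt)// (lt_trans ts).
apply: (@le_trans _ _ (g x)); first by rewrite /g lerDr ltW.
apply: (@derive_ge0_nondecr R 0 s g
  (fun y => derive1 v y - A * y `^ (- (L + 1)))) => // [y|y|]; last exact: ltW.
- by move=> /andP[y0 ys]; apply: is_deriveD; [exact: dv|exact: dpowL].
- move=> /andP[y0 ys]; have fy := phi_decr y0 ys sT.
  have fy0 := lt_trans fs fy.
  rewrite subr_ge0.
  rewrite (flux_gt0_derive y0 fy0).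
  apply: ler_wpM2r; first exact: powR_ge0.
  exact: (ge0_ler_powR (ltW a0) (ltW fs) (ltW fy0) (ltW fy)).
Qed.

(** If [- phi] stayed above some [e > 0], then [v] would grow like [x^(-L)] at 0, against its finite
    limit [d]. Monotonicity turns one small value into a limit. *)
Lemma flux_cvg0 : 0 < T -> - phi r @[r --> 0^'+] --> 0.
Proof.
move=> T0; apply/cvgrPdist_lt => e e0.
have [r rT fr] : exists2 r, 0 < r < T & - phi r < e.
  apply: contrapT => nex.
  have fe r : 0 < r < T -> e <= - phi r.
    by move=> rT; rewrite leNgt; apply/negP => fr; apply: nex; exists r.
  pose A := e `^ (p - 1)^-1.
  have A0 : 0 < A by exact: powR_gt0.
  have [t t0 vt] : exists2 t, 0 < t & forall r, 0 < r < t -> v r < d + 1.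
    apply: near_right0_ex; case: v_sol => _ vd; apply: (cvgr_lt _ vd).
    by rewrite ltrDl.
  case/andP: (half T0) => s0 sT; set s := T / 2 in s0 sT.
  pose g x := v x - A / L * x `^ (- L).
  have ts0 : 0 < Num.min t s by rewrite lt_min t0.
  have [x] := powRN_unbounded (d + 1 - g s) (divr_gt0 A0 L0) L0 ts0.
  move=> /andP[x0]; rewrite lt_min => /andP[xt xs].
  apply/negP; rewrite -leNgt.
  have vx : v x < d + 1 by rewrite vt// x0.
  suff : g s <= g x by rewrite {2}/g; lra.
  apply: (@derive_le0_nonincr R 0 T g
    (fun y => derive1 v y - - (A * y `^ (- (L + 1))))) => // [y|y|];
      last exact: ltW.
  - by move=> /andP[y0 ys]; apply: is_deriveB; [exact: dv|exact: dpowL].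
  - move=> yT; have fy := flux_lt0 yT; have ey := fe _ yT.
    case/andP: yT => y0 _.
    rewrite opprK (flux_lt0_derive y0 fy) addrC subr_le0.
    apply: ler_wpM2r; first exact: powR_ge0.
    exact: (ge0_ler_powR (ltW a0) (ltW e0) (le_trans (ltW e0) ey) ey).
case/andP: rT => r0 rT.
near=> x.
have x0 : 0 < x by near: x; exact: nbhs_right_gt.
have xr : x < r by near: x; exact: nbhs_right_lt.
have fx : phi x < 0 by rewrite flux_lt0// x0 (lt_trans xr).
rewrite sub0r opprK (ltr0_norm fx); apply: lt_trans fr.
by rewrite ltrN2; exact: (phi_decr x0 xr rT).
Unshelve. all: end_near. Qed.

Lemma regular_profile : 0 < T ->
  radial_profile n%:R p K d T v (fun r => - phi r).
Proof.
move=> T0; split; last exact: flux_cvg0; last by case: v_sol.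
move=> r rT; have fr := flux_lt0 rT; case/andP: (rT) => r0 _; split.
- exact: v_gt0.
- by rewrite oppr_gt0.
- by rewrite -(flux_lt0_derive r0 fr); exact: dv.
- by rewrite -[X in is_derive _ _ _ X]opprK; apply: is_deriveN; exact: dphi.
Qed.

End positive.
End regular.

(** * Existence of a first zero and positivity before it *)

Section zeros.
Variables (R : realType) (v : R -> R) (d : R).
Hypotheses (d0 : 0 < d) (vd : forall r, 0 < r -> derivable v r 1).
Hypothesis v_cvg : v r @[r --> 0^'+] --> d.
Implicit Types r s x : R.

Let v_cont r : 0 < r -> {for r, continuous v}.
Proof.
by move=> r0; apply: differentiable_continuous; rewrite -derivable1_diffP;
  exact: vd.
Qed.

Let v_pos : exists2 e, 0 < e & forall r, 0 < r < e -> 0 < v r.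
Proof. by apply: near_right0_ex; apply: (cvgr_gt _ v_cvg). Qed.

Lemma no_zero_gt0 T : (forall r, 0 < r < T -> v r != 0) ->
  forall r, 0 < r < T -> 0 < v r.
Proof.
move=> nz r rT; have vr := nz r rT; case/andP: (rT) => r0 rltT.
have [e e0 ve] := v_pos.
rewrite lt_neqAle eq_sym vr leNgt; apply/negP => vr0.
pose s := Num.min r (e / 2).
have s0 : 0 < s by rewrite lt_min r0 divr_gt0.
have sr : s <= r by rewrite ge_min lexx.
have se : s < e by rewrite gt_min ltr_pdivrMr// ltr_pMr// ltr1n orbT.
have vs : 0 < v s by rewrite ve// s0.
have cont : {within `[s, r], continuous v}.
  apply: derivable_within_continuous => x; rewrite in_itv/= => /andP[sx _].
  exact/vd/(lt_le_trans s0).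
have [|c] := IVT (v := 0) sr cont.
  by rewrite ge_min le_max (ltW vr0) (ltW vs) orbT.
rewrite in_itv/= => /andP[sc cr] vc.
by have := nz c; rewrite vc eqxx (lt_le_trans s0 sc)
  (le_lt_trans cr rltT) => /(_ isT).
Qed.

(** The infimum of the zeros is positive because [v > 0] near 0, and is itself a zero by continuity;
    the default value of [first_zero] is thus excluded. *)
Lemma first_zero_prop : crossing v -> is_first_zero v (first_zero v).
Proof.
move=> [z z0 vz].
suff [r hr] : exists r, is_first_zero v r by exact: (@xgetPex _ 0 _ (ex_intro _
  r hr)).
pose Z := [set r | 0 < r /\ v r = 0].
have Zz : Z z by split.
have [e e0 ve] := v_pos.
have Ze : lbound Z e.
  move=> x [x0 vx]; rewrite leNgt; apply/negP => xe.
  by have := ve x; rewrite vx x0 xe ltxx => /(_ isT).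
have Zlb : has_lbound Z by exists e.
have r0 : 0 < inf Z by apply: lt_le_trans e0 _; apply: lb_le_inf => //;
  exists z.
exists (inf Z); split => // [|s /andP[s0 sZ]]; last first.
  apply/eqP => vs; move: sZ; rewrite ltNge => /negP; apply.
  exact: ge_inf.
apply/eqP/negPn/negP => vr.
have /cvgrPdist_lt /(_ `|v (inf Z)|) := v_cont r0.
rewrite normr_gt0 => /(_ vr) [eps /= eps0 near_v].
have hZ : has_inf Z by split => //; exists z.
have [x Zx xr] := inf_adherent eps0 hZ.
have rx : inf Z <= x by exact: ge_inf.
have xb : ball_ Num.norm (inf Z) eps x.
  by rewrite /= distrC ger0_norm ?subr_ge0// ltrBlDl.
by have := near_v x xb; case: Zx => _ ->; rewrite /= subr0 ltxx.
Qed.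

Lemma first_zero_cvg r : 0 < r -> v r = 0 -> v s @[s --> r^'-] --> 0.
Proof. by move=> r0 vr; apply: cvg_at_left_filter; rewrite -vr;
  exact: v_cont. Qed.

End zeros.

(** * A power bound on the derivative of [K] *)

Section derivative_bound.
Variables (R : realType) (K dK h : R -> R) (A B l : R).
Hypotheses (B0 : 0 < B) (l0 : 0 < l).
Hypothesis dK_cont : {within `[0, +oo[%classic, continuous dK}.
Hypothesis dKE : forall r : R, 0 < r -> is_derive r 1 K (dK r).
Hypothesis K_eq : forall r : R, 0 <= r -> K r = A + B * r `^ l + h r.
Hypothesis h_small :
  (`|h r| + r * `|h^`()%classic r|) / r `^ l @[r --> 0^'+] --> 0.

(** Near 0 the expansion of [K] gives order [r^(l - 1)], which is at most [r^(k - 1)] for [r < 1];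
    away from 0, [dK x * x^(1 - k)] is continuous on a segment. The freedom [k <= l] matters when
    [l] is too large for the tail integral to converge. *)
Lemma derivative_power_bound (k M : R) : k <= l -> 0 < M ->
  exists2 C, 0 < C & forall r, 0 < r < M -> dK r <= C * r `^ (k - 1).
Proof.
move=> kl M0.
have dh r : 0 < r -> derive1 h r = dK r - B * (l * r `^ (l - 1)).
  move=> r0; rewrite derive1E.
  have H : is_derive r 1 (fun x => K x - (A + B * x `^ l))
      (dK r - (0 + B * (l * r `^ (l - 1)))).
    apply: is_deriveB; first exact: dKE.
    apply: is_deriveD.
    by apply: (is_derive_eq (is_deriveZ B (is_derive1_powR l r0))).
  rewrite add0r in H.
  suff [_ ->] : is_derive r 1 h (dK r - B * (l * r `^ (l - 1))) by [].
  apply: near_eq_is_derive H.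
  have /near_in_itvoy : r \in `]0, +oo[ by rewrite in_itv/= r0.
  apply: filterS => x; rewrite in_itv/= andbT => x0.
  by rewrite K_eq ?ltW//; ring.
have [e e0 he] : exists2 e, 0 < e & forall r, 0 < r < e ->
    (`|h r| + r * `|derive1 h r|) / r `^ l < 1.
  by apply: near_right0_ex; apply: (cvgr_lt _ h_small).
pose t := Num.min (Num.min e 1) M.
have t0 : 0 < t by rewrite !lt_min e0 M0 ltr01.
have tM : t <= M by rewrite ge_min lexx orbT.
have small r : 0 < r < t -> dK r <= (1 + B * l) * r `^ (k - 1).
  rewrite !lt_min => /and3P[r0 /andP[re r1] _].
  have rl := powR_gt0 l r0.
  have := he r; rewrite r0 re ltr_pdivrMr// mul1r => /(_ isT) hr.
  have rk : r `^ (l - 1) <= r `^ (k - 1).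
    by apply: ger_powR; [rewrite r0 ltW|rewrite lerD2r].
  have rl1 : r `^ l = r * r `^ (l - 1) by rewrite mulr_powRB1// ltW.
  have dhr : derive1 h r <= r `^ (l - 1).
    rewrite -(ler_pM2l r0) -rl1; apply: le_trans (ltW hr).
    by apply: ler_wpDl => //; rewrite ler_wpM2l ?(ltW r0)// ler_norm.
  have := dhr; rewrite dh// lerBlDr => /le_trans; apply.
  have -> : r `^ (l - 1) + B * (l * r `^ (l - 1)) =
    (1 + B * l) * r `^ (l - 1) by ring.
  by rewrite ler_wpM2l// addr_ge0// mulr_ge0// ltW.
have cont : {within `[t, M], continuous (fun x => dK x * x `^ (1 - k))}.
  have c1 : {within `[t, M], continuous dK}.
    apply: continuous_subspaceW dK_cont => x /=;
      rewrite !in_itv/= andbT => /andP[tx _].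
    exact: le_trans (ltW t0) tx.
  have c2 : {within `[t, M], continuous (fun x : R => x `^ (1 - k))}.
    apply: derivable_within_continuous => x; rewrite in_itv/= => /andP[tx _].
    by have [] := is_derive1_powR (1 - k) (lt_le_trans t0 tx).
  by move=> x; apply: cvgM; [exact: c1|exact: c2].
have [c _ hc] := EVT_max tM cont.
set g := dK c * c `^ (1 - k) in hc.
exists (1 + B * l + `|g|) => [|r /andP[r0 rM]].
  by apply: ltr_wpDr => //; apply: addr_gt0 => //; exact: mulr_gt0.
have rk := powR_ge0 r (k - 1).
have [rt|tr] := ltP r t.
  apply: le_trans (small r _) _; first by rewrite r0.
  by rewrite ler_wpM2r// lerDl.
have := hc r; rewrite in_itv/= tr (ltW rM) => /(_ isT) rg.
have -> : dK r = dK r * r `^ (1 - k) * r `^ (k - 1).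
  rewrite -mulrA -powRD ?(gt_eqF r0) ?implybT//.
  by rewrite (_ : 1 - k + (k - 1) = 0) ?powRr0 ?mulr1//; ring.
rewrite ler_wpM2r//; apply: le_trans rg _; apply: le_trans (ler_norm _) _.
by rewrite lerDr addr_ge0// mulr_ge0// ltW.
Qed.

End derivative_bound.

Theorem proposition43 (R : realType) (n : nat) (p : R)
  (K : R -> R) (u : R -> R -> R) (A B l : R) (h : R -> R)
  (n_gt0 : (0 < n)%N)
  (p_gt1 : 1 < p) (p_ltn : p < n%:R)
  (p_ge : 2 * n%:R / (n%:R + 2) <= p) (p_le2 : p <= 2)
  (K_gt0 : forall r : R, 0 <= r -> 0 < K r)
  (K_C1 : C1_halfline K)
  (u_sol : forall d : R, 0 < d -> regular_solution n p K d (u d))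
  (A_gt0 : 0 < A) (B_gt0 : 0 < B) (l_gt0 : 0 < l)
  (K_eq : forall r : R, 0 <= r -> K r = A + B * r `^ l + h r)
  (h_small : (`|h r| + r * `|h^`()%classic r|) / r `^ l @[r --> 0^'+] --> 0)
  (K_nondecr : forall r s : R, 0 <= r -> r <= s -> K r <= K s)
  (K_incr : exists a b : R, [/\ 0 <= a, a < b &
     forall r s : R, a <= r -> r < s -> s <= b -> K r < K s]) :
  let l_star := (n%:R - p) / (p - 1) in
  let Rz := fun d : R => first_zero (u d) in
  [/\ crossing_data u = [set d : R | 0 < d],
      l = l_star -> (0 < limf_einf (fun d => (Rz d)%:E) +oo%R)%E &
      l > l_star -> Rz d @[d --> +oo] --> +oo].
Proof.
move=> l_star Rz.
have [dK [dK_cont dKE _]] := K_C1.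
have K0 : 0 < K 0 by exact: K_gt0.
have K_ge r : 0 < r -> K 0 <= K r by move=> r0; rewrite K_nondecr// ltW.
have K_nd r s : 0 < r -> r <= s -> K r <= K s.
  by move=> r0; apply: K_nondecr; exact: ltW.
have K_gt r : 0 < r -> 0 < K r by move=> /ltW; exact: K_gt0.
have dK_ge0 r : 0 < r -> 0 <= dK r.
  move=> r0; apply: (nondecr_derive_ge0 r0 _ K_nd (dKE r r0)) => s s0.
  by have [] := dKE s s0.
have L0 : 0 < l_star by rewrite divr_gt0// subr_gt0.
have b0 : 0 < p / (n%:R - p) by rewrite divr_gt0 ?subr_gt0// (lt_trans ltr01).
have ud d r : 0 < d -> 0 < r -> derivable (u d) r 1.
  by move=> d0 r0; have [h1 _] := u_sol d d0; have [] := h1 r r0.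
have u_cvg d : 0 < d -> u d r @[r --> 0^'+] --> d by move=> /u_sol[].
have profile d T : 0 < d -> 0 < T -> (forall r, 0 < r < T -> u d r != 0) ->
    radial_profile n%:R p K d T (u d) (fun r => - flux n p (u d) r).
  move=> d0 T0 nz; apply: (regular_profile p_gt1 p_ltn K_gt (u_sol d d0)) => //.
  exact: (no_zero_gt0 d0 (ud d ^~ d0) (u_cvg d d0)).
have cross d : 0 < d -> crossing (u d).
  move=> d0; apply: contrapT => nocross.
  have nz r : 0 < r -> u d r != 0.
    by move=> r0; apply/eqP => ur; apply: nocross; exists r.
  have [a [b [a0 ab Kab]]] := K_incr.
  (* The midpoint replaces [a], which may be 0, since the first radius must be positive. *)
  apply: (@no_global_profile R n%:R p p_gt1 p_ltn K dK (K 0) K0 K_ge dKE dK_ge0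
    d (u d) (fun r => - flux n p (u d) r) d0 _ ((a + b) / 2) b).
  (* An arbitrary [T], possibly nonpositive, is reached by restriction from [|T| + 1]. *)
  - move=> T; have [|r /andP[r0 _]|H ? ?] := profile d (`|T| + 1) d0;
      [by rewrite ltr_wpDl|exact: nz|].
    split=> // r /andP[r0 rT]; apply: H.
    rewrite r0/= (lt_le_trans rT)//; apply: le_trans (ler_norm T) _.
    by rewrite lerDl.
  - by move: a0 ab; lra.
  - by move: a0 ab; lra.
  - by apply: Kab; move: a0 ab; lra.
have Rz_zero d : 0 < d -> is_first_zero (u d) (Rz d).
  by move=> d0; apply: (first_zero_prop d0 (ud d ^~ d0) (u_cvg d d0)
    (cross d d0)).
have Rz_gt0 d : 0 < d -> 0 < Rz d by move=> /Rz_zero[].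
(* The constant depends on [M] through [K M] and the bound on [dK], but not on [d]. *)
have bound (M k : R) : 0 < M -> 0 < k -> k <= l -> k < n%:R / (p - 1) ->
    exists2 C, 0 < C & forall d, 0 < d -> Rz d <= M ->
      Rz d `^ (- l_star) <= C * d `^ (p / (n%:R - p) * (l_star - k)).
  move=> M0 k0 kl kN.
  have [C C0 dK_le] := derivative_power_bound B_gt0 l_gt0 dK_cont dKE K_eq
    h_small kl M0.
  pose c := zero_const n%:R p (K 0) (K M) C k.
  exists (Num.max c 1) => [|d d0 RM]; first by rewrite lt_max ltr01 orbT.
  have [R0 uR nz] := Rz_zero d d0.
  have K_le r : 0 < r < Rz d -> K r <= K M.
    by move=> /andP[r0 rR]; rewrite K_nd// ltW// (lt_le_trans rR).
  have dK_le' r : 0 < r < Rz d -> dK r <= C * r `^ (k - 1).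
    by move=> /andP[r0 rR]; rewrite dK_le// r0 (lt_le_trans rR).
  have := zero_powN_le p_gt1 p_ltn K0 K_ge dKE dK_ge0 d0 (profile d _ d0 R0 nz)
    K_le R0 (first_zero_cvg (ud d ^~ d0) R0 uR) C0 k0 dK_le' kN.
  move=> /le_trans; apply; rewrite ler_wpM2r ?powR_ge0//.
  by rewrite le_max lexx.
have LN : l_star < n%:R / (p - 1).
  by rewrite ltr_pM2r ?invr_gt0 ?subr_gt0// ltrBlDr ltrDl (lt_trans ltr01).
have inv_bound (T x : R) : 0 < T -> 0 < x -> T `^ (- l_star) <= x ->
  x `^ (- l_star^-1) <= T.
  move=> T0 x0; rewrite !powRN -[leLHS]div1r ler_pdivrMr ?powR_gt0// => H.
  rewrite -[leLHS]div1r ler_pdivrMr ?powR_gt0//.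
  have -> : T = (T `^ l_star) `^ l_star^-1.
    by rewrite -powRrM mulfV ?gt_eqF// powRr1// ltW.
  rewrite -powRM ?powR_ge0 ?(ltW x0)// mulrC.
  have := ge0_ler_powR (r := l_star^-1) _ _ _ H.
  rewrite powR1; apply; rewrite ?nnegrE ?invr_ge0 ?(ltW L0)//.
  by rewrite mulr_ge0 ?powR_ge0// ltW.
split.
- by apply/seteqP; split => d /=; [case|move=> d0; split => //; exact: cross].
- move=> lL.
  have [C C0 HC] := bound 1 l ltr01 l_gt0 (lexx l) (eq_ind_r (fun x =>
    x < _) LN lL).
  (* For [l = l_star] the power of [d] is 0, so zeros below 1 are bounded away from 0 uniformly in
     [d]. *)
  pose e := Num.min 1 (C `^ (- l_star^-1)).
  have e0 : 0 < e by rewrite lt_min ltr01 powR_gt0.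
  have Re d : 0 < d -> e <= Rz d.
    move=> d0; rewrite ge_min; have [//|/ltW R1] := leP 1 (Rz d).
    rewrite inv_bound ?Rz_gt0//; apply: le_trans (HC d d0 R1) _.
    by rewrite lL subrr mulr0 powRr0 mulr1.
  rewrite limf_einfE; apply: (@lt_le_trans _ _ (e%:E));
    first by rewrite lte_fin.
  apply: (@le_trans _ _ (ereal_inf ((fun d => (Rz d)%:E) @` [set d | 0 < d]))).
    by apply: le_ereal_inf_tmp => _ [d d0 <-]; rewrite lee_fin Re.
  (* The lower limit is a supremum of infima over neighbourhoods of infinity, and the positive
     half-line is one of them. *)
  apply: ereal_sup_ubound; exists [set d | 0 < d] => //.
  exact: nbhs_pinfty_gt.
- move=> lL; apply/cvgryPgt => M.
  pose M1 := Num.max M 1.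
  have M10 : 0 < M1 by rewrite lt_max ltr01 orbT.
  (* An exponent strictly between [l_star] and [n / (p - 1)] and at most [l]: the power of [d]
     becomes negative while the tail integral still converges. *)
  pose k := Num.min l ((l_star + n%:R / (p - 1)) / 2).
  have kL : l_star < k by rewrite lt_min lL; move: LN; lra.
  have kl : k <= l by rewrite ge_min lexx.
  have kN : k < n%:R / (p - 1) by rewrite gt_min; apply/orP; right; move: LN;
    lra.
  have [C C0 HC] := bound M1 k M10 (lt_trans L0 kL) kl kN.
  pose g := p / (n%:R - p) * (k - l_star).
  have g0 : 0 < g by rewrite mulr_gt0// subr_gt0.
  (* For [d > y^(1 / g)] one has [C * d^(-g) < M1^(-l_star)], which rules out a first zero at most
     [M1]. *)
  pose y := C / M1 `^ (- l_star).
  have y0 : 0 < y by rewrite divr_gt0// powR_gt0.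
  near=> d.
  have yd : y `^ g^-1 < d by near: d; exact: nbhs_pinfty_gt.
  have d0 : 0 < d by apply: lt_trans yd; exact: powR_gt0.
  apply: (@le_lt_trans _ _ M1); first by rewrite le_max lexx.
  rewrite ltNge; apply/negP => RM.
  have := HC d d0 RM.
  rewrite (_ : _ * (l_star - k) = - g); last by rewrite /g; ring.
  apply/negP; rewrite -ltNge.
  apply: (@lt_le_trans _ _ (M1 `^ (- l_star))); last first.
    rewrite !powRN lef_pV2 ?posrE ?powR_gt0 ?Rz_gt0//.
    by rewrite ge0_ler_powR ?nnegrE ?(ltW L0) ?(ltW M10)// ltW// Rz_gt0.
  rewrite powRN ltr_pdivrMr ?powR_gt0// -ltr_pdivrMl ?powR_gt0// mulrC -/y.
  have -> : y = (y `^ g^-1) `^ g by rewrite -powRrM mulVf ?gt_eqF// powRr1//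
    ltW.
  by rewrite gt0_ltr_powR ?nnegrE ?powR_ge0// ltW.
Unshelve. all: end_near. Qed.
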